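(* Let $q,k\in\mathbb N_1$, $\mathbf n=(n_1,\dots,n_q)\in\mathbb N_0^q$, $\mathbf s_1,\dots,\mathbf s_q\in\mathbb R^k$, and $\boldsymbol\alpha\in(0,\infty)^k$. Then $$\int_{\Delta^{k-1}}\prod_{j=1}^q(\mathbf s_j\cdot\mathbf x)^{n_j}\,dD_{\boldsymbol\alpha}(\mathbf x)=\frac{|\mathbf n|!}{\langle|\boldsymbol\alpha|\rangle_{|\mathbf n|}}\,\mathscr Z^{(q)}_{\mathbf n}[\mathbf S;\boldsymbol\alpha],$$ where $D_{\boldsymbol\alpha}$ is the Dirichlet distribution on $\Delta^{k-1}$ and $\mathscr Z^{(q)}_{\mathbf n}[\mathbf S;\boldsymbol\alpha]$ is the pattern inventory, with $\mathbf S=(\mathbf s_1,\dots,\mathbf s_q)\in\mathbb R^{k\times q}$.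
   Context: Notation: $\mathbb N_1=\{1,2,\dots\}$, $\mathbb N_0=\{0,1,\dots\}$, $[n]=\{1,\dots,n\}$, $\mathbb N^q_*=\mathbb N_0^q\setminus\{\mathbf 0\}$, $0^0=1$; $|\cdot|$ is the sum of absolute values of the entries; $\langle\alpha\rangle_n=\alpha(\alpha+1)\cdots(\alpha+n-1)$; $\Delta^{k-1}=\{\mathbf x\in[0,1]^k:|\mathbf x|=1\}$. For vectors in $\mathbb R^k$, $\diamond$ denotes the entrywise product, $\mathbf s^{\diamond m}$ the entrywise $m$-th power, and $\cdot$ the scalar product. $D_{\boldsymbol\alpha}$ is the probability measure on $\Delta^{k-1}$ with density $\frac{\Gamma(\alpha_1+\dots+\alpha_k)}{\Gamma(\alpha_1)\cdots\Gamma(\alpha_k)}\prod_ix_i^{\alpha_i-1}$ ($D_\alpha=\delta_1$ when $k=1$). An $\mathbf n$-coloring is a map $\mathsf C_{\mathbf n}\colon[|\mathbf n|]\to[q]$ with exactly $n_j$ elements of color $j$ for each $j\in[q]$; fix one (quantities below depend only on $\mathbf n$). A $q$-chromatic partition is a finitely supported map $A\colon\mathbb N^q_*\to\mathbb N_0$. For a permutation $\pi$ of $[|\mathbf n|]$ let $\mathsf{color}(\pi)$ be the $q$-chromatic partition $A_\pi$ where $A_\pi(\mathbf a)$ is the number of cycles of $\pi$ (including fixed points) containing, for each $j\in[q]$, exactly $a_j$ elements of color $j$. For $\mathbf a\le\mathbf n$ coordinatewise set $\omega_{\mathbf a}[\mathbf S;\boldsymbol\alpha]=(\mathbf s_1^{\diamond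 a_1}\diamond\cdots\diamond\mathbf s_q^{\diamond a_q})\cdot\boldsymbol\alpha=\sum_{i=1}^k\alpha_i\prod_{j=1}^q(\mathbf s_j)_i^{a_j}$, and $w[\mathbf S;\boldsymbol\alpha](A)=\prod_{\mathbf a\in\mathrm{supp}A}\omega_{\mathbf a}[\mathbf S;\boldsymbol\alpha]^{A(\mathbf a)}$. The pattern inventory is $$\mathscr Z^{(q)}_{\mathbf n}[\mathbf S;\boldsymbol\alpha]=\frac1{|\mathbf n|!}\sum_{\pi\in\mathfrak S_{|\mathbf n|}}w[\mathbf S;\boldsymbol\alpha](\mathsf{color}(\pi)),$$ with $\mathfrak S_n$ the symmetric group on $[n]$. *)

(* Defs.v *)
From HB Require Import structures.
From mathcomp Require Import all_boot all_order all_algebra fingroup perm.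
From mathcomp Require Import finmap.
From mathcomp Require Import all_classical all_reals all_analysis.
From mathcomp Require Import measurable_realfun measurable_fun_approximation.

Set Implicit Arguments.
Unset Strict Implicit.
Unset Printing Implicit Defensive.

Import Order.TTheory GRing.Theory Num.Theory.
Import numFieldNormedType.Exports.

Local Open Scope classical_set_scope.
Local Open Scope ring_scope.

Definition l1norm (R : numDomainType) (k : nat) (a : 'I_k -> R) : R :=
  \sum_(i < k) `|a i|.

Definition rising_factorial (R : pzSemiRingType) (x : R) (n : nat) : R :=
  \prod_(i < n) (x + i%:R).

Definition Gamma (R : realType) (a : R) : R :=
  \int[lebesgue_measure]_(t in `]0, +oo[) (t `^ (a - 1) * expR (- t)).

Lemma Gamma_ge0 (R : realType) (a : R) : 0 <= Gamma a.
Proof.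
by apply: Rintegral_ge0 => t _; rewrite mulr_ge0 ?powR_ge0 ?expR_ge0.
Qed.

(* R^k with its Borel sigma-algebra, generated by the coordinates. *)
Notation vec k R := (k.-tuple (measurableTypeR R)).

Section lebesgue_cons.
Context (R : realType) (n : nat).
Variable m : {sigma_finite_measure set (vec n R) -> \bar R}.

Definition cons_pair (p : measurableTypeR R * vec n R) : vec n.+1 R :=
  [tuple of p.1 :: p.2].

Lemma measurable_cons_pair : measurable_fun [set: _] cons_pair.
Proof. exact: measurable_cons. Qed.

Definition lebesgue_cons : set (vec n.+1 R) -> \bar R :=
  pushforward (@lebesgue_measure R \x m)%E cons_pair.

HB.instance Definition _ := Measure.copy lebesgue_cons
  (measure_function_pushforward__canonical__measure_function_Measure
    (@lebesgue_measure R \x m)%E measurable_cons_pair).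

Let lebesgue_cons_sigma_finite : sigma_finite [set: _] lebesgue_cons.
Proof.
have /sigma_finiteP[F [FT ndF Foo]] := sigma_finiteT (@lebesgue_measure R).
have /sigma_finiteP[G [GT ndG Goo]] := sigma_finiteT m.
pose g (t : vec n.+1 R) : measurableTypeR R * vec n R :=
  (tnth t ord0, [tuple of behead t]).
have mg : measurable_fun [set: _] g.
  apply/measurable_fun_pairP; split.
  - exact: measurable_tnth.
  - exact: measurable_behead.
have gK : cancel cons_pair g.
  by move=> [x y]; rewrite /g /cons_pair/=; congr pair; apply/val_inj.
exists (fun i => g @^-1` (F i `*` G i)).
  apply/esym/seteqP; split => // t _.
  have [i _ Fi] : (\bigcup_i F i) (g t).1 by rewrite -FT.
  have [j _ Gj] : (\bigcup_i G i) (g t).2 by rewrite -GT.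
  exists (maxn i j) => //; split.
  - by move: Fi; exact/subsetPset/ndF/leq_maxl.
  - by move: Gj; exact/subsetPset/ndG/leq_maxr.
move=> i; have [? ?] := Foo i; have [? ?] := Goo i; split.
  by rewrite -[X in measurable X]setTI; apply: mg => //; exact: measurableX.
rewrite /lebesgue_cons /pushforward (_ : _ @^-1` _ = F i `*` G i).
  by rewrite product_measure1E// lte_mul_pinfty// ge0_fin_numE.
by apply/seteqP; split=> p; rewrite /preimage /mkset gK.
Qed.

HB.instance Definition _ :=
  Measure_isSigmaFinite.Build _ _ _ lebesgue_cons lebesgue_cons_sigma_finite.
End lebesgue_cons.

Fixpoint lebesgue_tuple (R : realType) (n : nat) :
    {sigma_finite_measure set (vec n R) -> \bar R} :=
  match n with
  | 0 => \d_([tuple] : vec 0 R)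
  | n'.+1 => lebesgue_cons (lebesgue_tuple R n')
  end.

Section dirichlet.
Context (R : realType) (k : nat).

Definition simplex : set (vec k R) :=
  [set x | (forall i, 0 <= tnth x i <= 1) /\ l1norm (tnth x) = 1].

(* The affine hyperplane \sum_i x_i = 1 is identified with R^(k-1) through its
   first k - 1 coordinates, the last one being determined by them. *)
Definition simplex_chart (y : vec k.-1 R) : vec k R :=
  [tuple if (i.+1 < k)%N then nth 0 y i else 1 - \sum_(j < k.-1) tnth y j
   | i < k].

Variable alpha : 'I_k -> R.

Definition dirichlet_pdf (x : vec k R) : R :=
  Gamma (\sum_(i < k) alpha i) / (\prod_(i < k) Gamma (alpha i)) *
  \prod_(i < k) (tnth x i) `^ (alpha i - 1).

Lemma dirichlet_pdf_ge0 x : 0 <= dirichlet_pdf x.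
Proof.
rewrite /dirichlet_pdf mulr_ge0 ?divr_ge0 ?Gamma_ge0//.
- by apply: prodr_ge0 => i _; exact: Gamma_ge0.
- by apply: prodr_ge0 => i _; exact: powR_ge0.
Qed.

Lemma measurable_simplex : measurable simplex.
Proof.
have mt i : measurable_fun setT (fun x : vec k R => tnth x i : R).
  exact: measurable_tnth.
rewrite /simplex (_ : [set x | _] =
  (\bigcap_(i in [set: 'I_k]) ((fun x : vec k R => tnth x i : R) @^-1` `[0, 1]))
  `&` ((fun x : vec k R => l1norm (tnth x)) @^-1` [set 1])); last first.
  apply/seteqP; split => x /=.
    by move=> [x01 ->]; split=> // i _ /=; rewrite in_itv/=.
  by move=> [x01 ->]; split=> // i; have /= := x01 i I; rewrite in_itv.
apply: measurableI.
  apply: fin_bigcap_measurable => // i _.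
  by rewrite -[X in measurable X]setTI; exact: mt.
rewrite -[X in measurable X]setTI.
suff : measurable_fun setT (fun x : vec k R => l1norm (tnth x)) by exact.
apply: (@measurable_sum _ _ _ _ _ _ (fun i (x : vec k R) => `|tnth x i|)) => i.
by apply: measurableT_comp => //; exact: mt.
Qed.

Lemma measurable_simplex_chart : measurable_fun [set: _] simplex_chart.
Proof.
apply/measurable_fun_tnthP => i.
rewrite [X in measurable_fun _ X](_ : _ = fun y : vec k.-1 R =>
  if (i.+1 < k)%N then nth 0 y i else 1 - \sum_(j < k.-1) tnth y j); last first.
  by apply/funext => y /=; rewrite tnth_mktuple.
case: (boolP (i.+1 < k)%N) => ik.
  have ik' : (i < k.-1)%N by rewrite -ltnS (ltn_predK ik).
  rewrite (_ : (fun _ => _) = fun y : vec k.-1 R => tnth y (Ordinal ik')).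
    exact: measurable_tnth.
  by apply/funext => y; rewrite (tnth_nth 0).
have ms : measurable_fun [set: vec k.-1 R]
    (fun y => \sum_(j < k.-1) (tnth y j : R)).
  apply: (@measurable_sum _ _ _ _ _ _ (fun j (y : vec k.-1 R) => tnth y j)).
  by move=> j; exact: measurable_tnth.
by apply: (measurable_funB (f := cst 1)) ms.
Qed.

Lemma measurable_dirichlet_pdf : measurable_fun [set: _] dirichlet_pdf.
Proof.
apply: measurable_funM => //.
apply: (@measurable_prod _ _ _ _ _ _
  (fun i (x : vec k R) => (tnth x i) `^ (alpha i - 1))) => i _.
apply: (measurableT_comp (measurable_powR (alpha i - 1))).
exact: measurable_tnth.
Qed.

(* At boundary points of the simplex, where a factor x_i^(alpha_i - 1) may be
   undefined, the integrand takes the junk value of powR: this is a null set. *)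
Definition dirichlet_ac (A : set (vec k R)) : \bar R :=
  (\int[lebesgue_tuple R k.-1]_(y in simplex_chart @^-1` (simplex `&` A))
     (dirichlet_pdf (simplex_chart y))%:E)%E.

Let dirichlet_ac0 : dirichlet_ac set0 = 0%E.
Proof. by rewrite /dirichlet_ac setI0 preimage_set0 integral_set0. Qed.

Let dirichlet_ac_ge0 A : (0 <= dirichlet_ac A)%E.
Proof. by apply: integral_ge0 => y _; rewrite lee_fin dirichlet_pdf_ge0. Qed.

Let dirichlet_ac_sigma_additive : semi_sigma_additive dirichlet_ac.
Proof.
move=> F mF tF mUF; rewrite /dirichlet_ac setI_bigcupr preimage_bigcup.
apply: (@semi_sigma_additive_nng_induced _ _ _ (lebesgue_tuple R k.-1)
  (fun y => (dirichlet_pdf (simplex_chart y))%:E)).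
- apply/measurable_EFinP; apply: measurableT_comp.
    exact: measurable_dirichlet_pdf.
  exact: measurable_simplex_chart.
- by move=> y; rewrite lee_fin dirichlet_pdf_ge0.
- move=> i; rewrite -[X in measurable X]setTI.
  apply: measurable_simplex_chart => //.
  by apply: measurableI => //; exact: measurable_simplex.
- apply/trivIsetP => i j _ _ ij; rewrite -preimage_setI setIACA.
  by move/trivIsetP : tF => /(_ i j I I ij) ->; rewrite setI0 preimage_set0.
- rewrite -preimage_bigcup -setI_bigcupr -[X in measurable X]setTI.
  apply: measurable_simplex_chart => //.
  by apply: measurableI => //; exact: measurable_simplex.
Qed.

HB.instance Definition _ := isMeasure.Build _ _ _
  dirichlet_ac dirichlet_ac0 dirichlet_ac_ge0 dirichlet_ac_sigma_additive.

Definition dirichlet : {measure set (vec k R) -> \bar R} :=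
  if (k == 1)%N as _ return {measure set (vec k R) -> \bar R}
  then \d_([tuple 1 | i < k] : vec k R) else dirichlet_ac.
End dirichlet.
Arguments simplex : clear implicits.

Definition is_coloring (q : nat) (n : 'I_q -> nat)
    (C : 'I_(\sum_(j < q) n j) -> 'I_q) : Prop :=
  forall j : 'I_q, #|[set i | C i == j]%SET| = n j.
Arguments is_coloring {q} n C.

Lemma is_coloring_exists (q : nat) (n : 'I_q -> nat) :
  exists C, is_coloring n C.
Proof.
have cardT : #|{: {j : 'I_q & 'I_(n j)}}| = (\sum_(j < q) n j)%N.
  by rewrite card_tagged sumnE big_map big_enum; apply: eq_bigr => j _;
     rewrite card_ord.
pose f i := enum_val (cast_ord (esym cardT) i).
have finj : injective f by move=> x y /enum_val_inj/cast_ord_inj.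
exists (fun i => tag (f i)) => j.
have fcard : (#|{: {j : 'I_q & 'I_(n j)}}| <= #|'I_(\sum_(j < q) n j)|)%N.
  by rewrite cardT card_ord.
rewrite -(card_imset _ finj) -[RHS]card_ord.
rewrite -(card_imset predT
  (f := fun x : 'I_(n j) => Tagged (fun j => 'I_(n j)) x)); last first.
  by move=> x y /eqP; rewrite eq_Tagged => /eqP.
apply: eq_card => -[j' x]; apply/imsetP/imsetP => /=.
  move=> [i + jE]; rewrite inE -jE/= => /eqP jj; subst j'.
  by exists x.
move=> [y _ ->].
have [g fK gK] := inj_card_bij finj fcard.
by exists (g (Tagged _ y)); rewrite ?inE gK//=.
Qed.

Section pattern_inventory.

Definition pos_multiindex (q : nat) :=
  {a : {ffun 'I_q -> nat} | a != [ffun=> 0%N]}.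

Definition chromatic_partition (q : nat) :=
  {fsfun pos_multiindex q -> nat with 0%N}.

Section color.
Context (q N : nat) (C : 'I_N -> 'I_q) (p : 'S_N).

Definition cycle_colors (c : {set 'I_N}) : {ffun 'I_q -> nat} :=
  [ffun j => #|[set i in c | C i == j]%SET|].

Definition cycle_count (a : pos_multiindex q) : nat :=
  #|[set c in porbits p | cycle_colors c == val a]%SET|.

Definition cycle_types : {fset pos_multiindex q} :=
  seq_fset tt (pmap insub [seq cycle_colors c | c <- enum (porbits p)]).

Definition color : chromatic_partition q :=
  [fsfun a in cycle_types => cycle_count a | 0%N].

Lemma colorE a : color a = cycle_count a.
Proof.
rewrite fsfunE; case: ifPn => // /negP aNc; apply/esym/eqP.
rewrite /cycle_count cards_eq0; apply/eqP/setP => c; rewrite !inE.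
apply/negP => /andP[cp /eqP ca]; apply: aNc.
rewrite /cycle_types seq_fsetE mem_pmap_sub.
by apply/mapP; exists c => //; rewrite mem_enum.
Qed.

End color.

Section weight.
Context (R : realType) (q k : nat) (S : 'M[R]_(k, q)) (alpha : 'I_k -> R).

Definition omega (a : pos_multiindex q) : R :=
  \sum_(i < k) alpha i * \prod_(j < q) S i j ^+ val a j.

Definition weight (A : chromatic_partition q) : R :=
  \prod_(a <- finsupp A) omega a ^+ A a.

Definition pattern_inventory (N : nat) (C : 'I_N -> 'I_q) : R :=
  (N`!)%:R^-1 * \sum_(p : 'S_N) weight (color C p).

End weight.
End pattern_inventory.

(* Main.v *)
Require Import Defs.
Set Warnings "-all".
From mathcomp Require Import all_boot all_order all_algebra fingroup perm.
From mathcomp Require Import finmap.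
From mathcomp Require Import all_classical all_reals all_analysis.
From mathcomp Require Import measurable_realfun.
From mathcomp Require Import ring.

(** Both sides are computed by recursion, and both recursions lead to the same
    multilinear form in the vectors attached to the elements of [[|n|]].

    On the analytic side, the density of [D_alpha] satisfies
    [x_i * pdf_alpha = alpha_i / |alpha| * pdf_(alpha + e_i)], because
    [Gamma (a + 1) = a * Gamma a].  Hence multiplying an integrand by the linear
    form [u . x] replaces its integral by the combination with coefficients
    [u_i * alpha_i / |alpha|] of the integrals against [D_(alpha + e_i)].
    Peeling off the linear forms one after the other
    ([integral_dirichlet_prod]) leaves the total masses, which are [1], and
    gives [polarized_rising us alpha / <|alpha|>_m], where [polarized_rising] is
    the multilinear form in the list [us] of vectors produced by the recursion
    (for [k = 1] and [u = 1] it is the rising factorial, whence the name).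

    On the combinatorial side, the sum over all permutations of the products of
    the cycle weights [\sum_i alpha_i * \prod_(l in c) u_l i] satisfies a
    recursion too ([cycle_sumU1]): a new element [x] either is a fixed point, or
    is inserted in a cycle just before an element [y], which has the same effect
    on the weights as replacing the vector [u_y] by the entrywise product of
    [u_y] and [u_x].  The form [polarized_rising] obeys this recursion with
    respect to its last argument ([polarized_rising_rcons]), so the two agree
    ([cycle_sumE]).  Taking [u_l] to be the vector attached to the color of [l]
    turns the cycle weights into the [omega_a] ([pattern_inventoryE]).

    That [D_alpha] has mass [1] is the Dirichlet integral
    ([dirichlet_integral]), proved by integrating out one coordinate at a time:
    the power functions [x^(a-1)] on the half-line form, up to the Beta
    constants, a convolution semigroup ([powpos_convolution]), and Tonelli's
    theorem expresses those constants by Gamma values ([egammaM]). *)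

Set Implicit Arguments.
Unset Strict Implicit.
Unset Printing Implicit Defensive.

Import Order.TTheory GRing.Theory Num.Theory.
Import numFieldNormedType.Exports.
Local Open Scope ring_scope.

(** * The multilinear rising factorial and sums over permutations *)

Section polarized_rising.
Variables (R : comNzRingType) (k : nat).
Implicit Types (al v : 'I_k -> R) (us : seq ('I_k -> R)).

Definition shift_at al (i j : 'I_k) : R := al j + (j == i)%:R.

Lemma sum_shift_at al i : \sum_j shift_at al i j = \sum_j al j + 1.
Proof.
rewrite big_split/=; congr (_ + _).
by rewrite (bigD1 i)//= eqxx big1 ?addr0// => j /negPf ->.
Qed.

(** This is the sum over all maps [f] from the positions of [us] to ['I_k] of
    [\prod_l us_l (f l)] times [\prod_i <al_i>_(m_i)], with [m_i] the size of
    the fibre of [f] over [i]: the recursion chooses [f] on the first position, and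
    the rising factorials are built through the shift of [al]. *)
Fixpoint polarized_rising us al : R :=
  if us is u :: us' then
    \sum_i u i * al i * polarized_rising us' (shift_at al i)
  else 1.

Definition scale_at (T : eqType) (u : T -> 'I_k -> R) (y : T) v (z : T)
  (i : 'I_k) : R :=
  if z == y then u z i * v i else u z i.

Lemma sum_mul_shift_at v al i :
  \sum_j v j * shift_at al i j = \sum_j v j * al j + v i.
Proof.
under eq_bigr do rewrite mulrDr; rewrite big_split/=; congr (_ + _).
by rewrite (bigD1 i)//= eqxx mulr1 big1 ?addr0// => j /negPf ->; rewrite mulr0.
Qed.

Lemma eq_in_polarized_rising (T : eqType) (f g : T -> 'I_k -> R) (s : seq T)
    al :
  {in s, forall z i, f z i = g z i} ->
  polarized_rising (map f s) al = polarized_rising (map g s) al.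
Proof.
elim: s al => //= z s IH al fg; apply: eq_bigr => i _.
rewrite fg ?mem_head// IH// => y ys; apply: fg; exact: mem_behead.
Qed.

(** The defining recursion peels off the first vector; the recursion over
    permutations inserts a last one.  The induction on [s] carries [v] through
    the shifted parameters: shifting [al] at [i] adds [v_i] to the coefficient of
    the first summand, and these extra terms are the summand in which [v] is
    multiplied into the head of the list. *)
Lemma polarized_rising_rcons (T : eqType) (u : T -> 'I_k -> R) (s : seq T)
    v al :
  uniq s ->
  polarized_rising (rcons (map u s) v) al =
  (\sum_i v i * al i) * polarized_rising (map u s) al +
  \sum_(y <- s) polarized_rising (map (scale_at u y v) s) al.
Proof.
elim: s al => [|z s IH] al /=; first by move=> _; rewrite big_nil addr0 mulr1;
  apply: eq_bigr => i _; rewrite mulr1.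
move=> /andP[zs us].
under eq_bigr => i _ do rewrite IH// sum_mul_shift_at mulrDl !mulrDr mulrCA.
rewrite !big_split/= -mulr_sumr -addrA; congr (_ + _).
rewrite big_cons /=; congr (_ + _).
  apply: eq_bigr => i _; rewrite /scale_at eqxx.
  rewrite (@eq_in_polarized_rising _ (scale_at u z v) u).
    by ring.
  by move=> y ys i'; rewrite /scale_at; case: eqP => // yz; move: zs;
    rewrite -yz ys.
under eq_bigr do rewrite mulr_sumr.
rewrite exchange_big/=; apply: eq_big_seq => y ys; apply: eq_bigr => i _.
by rewrite {2}/scale_at; case: eqP => // zy; move: zs; rewrite zy ys.
Qed.

End polarized_rising.

Section merge_porbit.
Import boot.fintype boot.finset.
Variables (T : finType) (s : {perm T}) (x y : T).
Hypotheses (sx : s x = x) (xy : x != y).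

Let O := porbit s y.

Lemma fix_porbit w : x \in porbit s w -> w = x.
Proof.
rewrite porbit_sym => /porbitP[i ->]; elim: i => [|i IH];
  first by rewrite perm1.
by rewrite expgSr permM IH sx.
Qed.

Lemma fix_notin_porbit : x \notin O.
Proof. by apply/negP => /fix_porbit yx; move: xy; rewrite yx eqxx. Qed.

(** Multiplying by the transposition of [x] and [y] inserts the fixed point [x]
    in the cycle of [y]: away from that cycle the two permutations have the same
    iterates. *)
Lemma porbit_mul_tperm_out z : z \notin x |: O ->
  porbit (s * tperm x y)%g z = porbit s z.
Proof.
rewrite in_setU1 negb_or => /andP[zx zO].
have e i : ((s * tperm x y) ^+ i)%g z = (s ^+ i)%g z.
  elim: i => [|i IH]; first by rewrite !expg0.
  rewrite !expgSr !permM IH tpermD//.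
    apply/negP => /eqP xE; move: zx; rewrite (@fix_porbit z) ?eqxx//.
    by rewrite [X in X \in _]xE -permM -expgSr mem_porbit.
  apply/negP => /eqP yE; move: zO; rewrite /O porbit_sym.
  by rewrite [X in X \in _]yE -permM -expgSr mem_porbit.
by apply/setP => w; apply/porbitP/porbitP => -[i ->]; exists i; rewrite e.
Qed.

Lemma porbit_mul_tperm_in : porbit (s * tperm x y)%g x = x |: O.
Proof.
have px : (s * tperm x y)%g x = y by rewrite permM sx tpermL.
apply/setP/subset_eqP/andP; split; apply/subsetP => w.
  move=> wx; apply: contraT => wO.
  move: wx; rewrite porbit_sym porbit_mul_tperm_out// => /fix_porbit wx.
  by move: wO; rewrite wx setU11.
rewrite in_setU1 => /orP[/eqP ->|/porbitP[i ->]]; first exact: porbit_id.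
have yp : y \in porbit (s * tperm x y)%g x.
  by have := mem_porbit (s * tperm x y)%g 1 x; rewrite expg1 px.
elim: i => [|i IH]; first by rewrite perm1.
have [->//|ny] := eqVneq ((s ^+ i.+1)%g y) y.
have nx : (s ^+ i.+1)%g y != x.
  by apply: contraNneq fix_notin_porbit => <-; rewrite mem_porbit.
rewrite -[X in X \in _](_ : (s * tperm x y)%g ((s ^+ i)%g y) = _).
  move: IH; rewrite -!eq_porbit_mem => /eqP <-; rewrite eq_porbit_mem.
  by have := mem_porbit (s * tperm x y)%g 1 ((s ^+ i)%g y); rewrite expg1.
have sE : s ((s ^+ i)%g y) = (s ^+ i.+1)%g y by rewrite expgSr permM.
by rewrite permM sE tpermD// eq_sym.
Qed.

End merge_porbit.

Section cycle_sum.
Import boot.fintype boot.finset.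
Variables (R : comNzRingType) (k : nat) (T : finType) (al : 'I_k -> R).
Implicit Types (u : T -> 'I_k -> R) (A c : {set T}).

Definition cycle_weight u c : R := \sum_i al i * \prod_(l in c) u l i.

(** Cycles outside of [A] are left out, so that permutations of the various
    subsets of [T] can all be handled as elements of [{perm T}]: for a
    permutation supported in [A], the omitted cycles are the fixed points
    outside of [A]. *)
Definition perm_weight u A (s : {perm T}) : R :=
  \prod_(c in porbits s | c \subset A) cycle_weight u c.

Definition cycle_sum u A : R :=
  \sum_(s : {perm T} | perm_on A s) perm_weight u A s.

Lemma cycle_sum0 u : cycle_sum u set0 = 1.
Proof.
rewrite /cycle_sum (big_pred1 1%g) => [|s]; last first.
  apply/idP/eqP => [s0|->]; last exact: perm_on1.
  by apply: perm_on_id s0 _; rewrite cards0.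
rewrite /perm_weight big_pred0// => c; apply/negP => /andP[/imsetP[z _ ->]].
by move/subsetP/(_ z (porbit_id _ _)); rewrite inE.
Qed.

Lemma eq_cycle_weight u u' c : {in c, forall l i, u l i = u' l i} ->
  cycle_weight u c = cycle_weight u' c.
Proof.
move=> uu'; apply: eq_bigr => i _; congr (_ * _).
by apply: eq_bigr => l lc; exact: uu'.
Qed.

Lemma perm_weight_fix u A x s : x \notin A -> perm_on A s ->
  perm_weight u (x |: A) s = cycle_weight u [set x] * perm_weight u A s.
Proof.
move=> xA sA; have sx : s x = x by exact: out_perm sA xA.
have px : porbit s x = [set x].
  apply/setP => w; rewrite inE; apply/porbitP/eqP => [[i ->]|->];
    last by exists 0; rewrite perm1.
  by elim: i => [|i IH]; rewrite ?perm1// expgSr permM IH.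
rewrite /perm_weight (bigD1 [set x])/=; last first.
  by rewrite -px imset_f// px sub1set setU11.
congr (_ * _); apply: eq_bigl => c; rewrite -andbA.
apply: andb_id2l => /imsetP[z _ ->].
apply/andP/idP => [[zA zx]|zA].
  apply/subsetP => w wz; move: (subsetP zA w wz);
    rewrite in_setU1 => /orP[/eqP wx|//].
  by move: zx; rewrite -px eq_porbit_mem porbit_sym -wx wz.
split; first by rewrite (subset_trans zA)// subsetUr.
apply: contraNneq xA => zx; apply: (subsetP zA); rewrite zx set11//.
Qed.

(** The cycles of [s * tperm x y] are those of [s], except that [x] has joined
    the cycle of [y]; the factor [u x] that it contributes to the weight of this
    cycle is transferred to [y]. *)
Lemma perm_weight_merge u A x y s : x \notin A -> y \in A -> perm_on A s ->
  perm_weight u (x |: A) (s * tperm x y)%g = perm_weight (scale_at u y (u x)) A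
    s.
Proof.
move=> xA yA sA; have sx : s x = x by exact: out_perm sA xA.
have xy : x != y by apply: contraNneq xA => ->.
set O := porbit s y; set t := (s * tperm x y)%g.
have fixx w : x \in porbit s w -> w = x by exact: fix_porbit.
have xO : x \notin O by apply/negP => /fixx yx; move: xy; rewrite yx eqxx.
have tin : porbit t x = x |: O by exact: porbit_mul_tperm_in.
have tout z : z \notin x |: O -> porbit t z =
  porbit s z by exact: porbit_mul_tperm_out.
pose m c := if c == O then x |: O else c.
pose P := [set c in porbits s | c \subset A].
have xP c : c \in P -> x \notin c.
  by rewrite inE => /andP[_ cA]; apply: contra xA; exact/subsetP.
have mP : [set c in porbits t | c \subset x |: A] = m @: P.
  apply/setP => c; rewrite inE; apply/andP/imsetP.
    move=> [/imsetP[z _ ->{c}] zA]; have [zO|zO] := boolP (z \in x |: O).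
      have tz : porbit t z = x |: O by rewrite -tin; apply/eqP;
        rewrite eq_porbit_mem tin.
      exists O; last by rewrite /m eqxx tz.
      rewrite inE imset_f//=; apply/subsetP => w wO.
      have := subsetP zA w; rewrite tz !in_setU1 wO orbT =>
        /(_ isT)/orP[/eqP wx|//].
      by move: xO; rewrite -wx wO.
    rewrite tout// in zA *.
    have [zx zO'] : z != x /\ z \notin O by move: zO;
      rewrite in_setU1 negb_or => /andP.
    exists (porbit s z); last by rewrite /m eq_porbit_mem (negPf zO').
    rewrite inE imset_f//=; apply/subsetP => w wz.
    have := subsetP zA w wz; rewrite in_setU1 => /orP[/eqP wx|//].
    by move: zx; rewrite (fixx z) ?eqxx// -wx.
  move=> [c' c'P ->{c}]; rewrite /m; case: eqP => [c'O|/eqP c'O].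
    rewrite -tin imset_f//; split=> //; rewrite tin -c'O setUS//.
    by move: c'P; rewrite inE => /andP[].
  move: (c'P); rewrite inE => /andP[/imsetP[z _ c'z] c'A].
  have zc : z \in c' by rewrite c'z porbit_id.
  split; last by rewrite (subset_trans c'A)// subsetUr.
  rewrite c'z -tout ?imset_f// in_setU1 negb_or; apply/andP; split.
    by apply: contraNneq (xP _ c'P) => <-.
  by rewrite -eq_porbit_mem -c'z.
have mI : {in P &, injective m}.
  move=> c1 c2 /xP x1 /xP x2; rewrite /m.
  have [->|_] := eqVneq c1 O; have [->|_] := eqVneq c2 O => // e.
    by move: x2; rewrite -e setU11.
  by move: x1; rewrite e setU11.
rewrite /perm_weight.
rewrite (eq_bigl (fun c => c \in m @: P)); last by move=> c; rewrite -mP inE.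
rewrite (big_imset _ mI) /=.
rewrite [RHS](eq_bigl (fun c => c \in P)); last by move=> c; rewrite inE.
apply: eq_bigr => c cP; rewrite /m; have [cO|cO] := eqVneq c O.
  apply: eq_bigr => i _; congr (_ * _); rewrite cO big_setU1//=.
  rewrite [in LHS](big_setD1 y) ?porbit_id//= [in RHS](big_setD1 y)
    ?porbit_id//=.
  rewrite {1}/scale_at eqxx mulrA [u x i * _]mulrC; congr (_ * _).
  by apply: eq_bigr => l; rewrite !inE /scale_at => /andP[/negPf ->].
apply: eq_cycle_weight => l lc i; rewrite /scale_at; case: eqP => // ly.
move: cP cO; rewrite inE => /andP[/imsetP[z _ cz] _].
by rewrite cz eq_porbit_mem porbit_sym -ly -cz lc.
Qed.

(** A permutation of [x |: A] is determined by the image [y] of [x] and by the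
    permutation of [A] obtained by removing [x] from its cycle, that is, by
    composing with the transposition of [x] and [y]. *)
Lemma cycle_sumU1 u A x : x \notin A ->
  cycle_sum u (x |: A) = cycle_weight u [set x] * cycle_sum u A +
    \sum_(y in A) cycle_sum (scale_at u y (u x)) A.
Proof.
move=> xA; rewrite /cycle_sum
  (partition_big (fun s : {perm T} => s x) (mem (x |: A))) /=; last first.
  move=> s sA; rewrite perm_closed//; exact: setU11.
have reindex y : y \in x |: A ->
  \sum_(s : {perm T} | perm_on (x |: A) s && (s x == y)) perm_weight u (x |: A)
    s =
  \sum_(s | perm_on A s) perm_weight u (x |: A) (s * tperm x y)%g.
  move=> yA.
  have tA : perm_on (x |: A) (tperm x y).
    by apply: subset_trans (tperm_on x y) _; rewrite subUset !sub1set setU11.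
  rewrite (reindex_inj (mulIg (tperm x y))); apply: eq_bigl => s.
  apply/andP/idP => [[sA]|sA].
    rewrite permM => /eqP sxy.
    have sx : s x = x by apply: (@perm_inj _ (tperm x y)); rewrite sxy tpermL.
    have {}sA : perm_on (x |: A) s.
      by rewrite -[s](mulgK (tperm x y)) tpermV perm_onM.
    apply/subsetP => w; rewrite inE => sw.
    have := subsetP sA w sw; rewrite in_setU1 => /orP[/eqP wx|//].
    by move: sw; rewrite wx sx eqxx.
  split; last by rewrite permM (out_perm sA xA) tpermL.
  by apply: perm_onM => //; apply: subset_trans sA _; exact: subsetUr.
rewrite big_setU1//=; congr (_ + _).
  rewrite reindex ?setU11// mulr_sumr; apply: eq_bigr => s sA.
  by rewrite tperm1 mulg1 perm_weight_fix.
apply: eq_bigr => y yA; rewrite reindex ?setU1r//; apply: eq_bigr => s sA.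
exact: perm_weight_merge.
Qed.

Lemma cycle_sumE u (s : seq T) : uniq s ->
  cycle_sum u [set x in s] = polarized_rising (map u s) al.
Proof.
elim/last_ind: s u => [|s x IH] u;
  first by rewrite (_ : [set _ in _] = set0) ?cycle_sum0//; apply/setP => z;
    rewrite !inE.
rewrite rcons_uniq => /andP[xs us].
have -> : [set z in rcons s x] = x |: [set z in s].
  by apply/setP => z; rewrite !inE mem_rcons inE.
rewrite cycle_sumU1 ?inE// map_rcons polarized_rising_rcons// IH//;
  congr (_ * _ + _).
  by apply: eq_bigr => i _; rewrite big_set1 mulrC.
rewrite (eq_bigl (mem s)); last by move=> y; rewrite inE.
rewrite -big_uniq//; apply: eq_bigr => y _; exact: IH.
Qed.

End cycle_sum.

Local Open Scope classical_set_scope.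

(** * Euler integrals *)

Section one_dim.
Context {R : realType}.
Local Notation mu := (@lebesgue_measure R).

Lemma lebesgue_measure_shift (c : R) (A : set R) : measurable A ->
  pushforward mu (fun x => x + c : measurableTypeR R) A = mu A.
Proof.
move=> mA.
have mf : measurable_fun [set: measurableTypeR R]
  (fun x => x + c : measurableTypeR R).
  exact: measurable_funD.
pose nu : {measure set (measurableTypeR R) -> \bar R} :=
  measure_function_pushforward__canonical__measure_function_Measure mu mf.
apply/esym/(lebesgue_measure_unique (mu := nu)) => //= _ [[a b]] _ <-.
rewrite /nu /pushforward/= (_ : _ @^-1` _ = `]a - c, b - c]%classic);
  last first.
  by apply/seteqP; split => x /=; rewrite !in_itv/= ltrBlDr lerBrDr.
rewrite !lebesgue_measure_itv/= !lte_fin ltrD2r.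
by case: ifPn => // _; rewrite -!EFinB; congr EFin; ring.
Qed.

Lemma lebesgue_measure_dilation (c : R) (c0 : 0 < c) (A : set R) :
  measurable A ->
  (c%:E * pushforward mu (fun x => (c * x)%R : measurableTypeR R) A)%E = mu A.
Proof.
move=> mA.
have mf : measurable_fun [set: measurableTypeR R]
  (fun x => c * x : measurableTypeR R).
  exact: measurable_funM.
pose nu : {measure set (measurableTypeR R) -> \bar R} :=
  measure_function_pushforward__canonical__measure_function_Measure mu mf.
pose nu' := mscale (NngNum (ltW c0)) nu.
apply/esym/(lebesgue_measure_unique (mu := nu')) => //= _ [[a b]] _ <-.
rewrite /nu' /= /mscale /nu /= /pushforward (_ : _ @^-1` _ = `]a / c,
  b / c]%classic); last first.
  by apply/seteqP; split => x /=;
    rewrite !in_itv/= ltr_pdivrMr// ler_pdivlMr// !(mulrC x).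
rewrite !lebesgue_measure_itv/= !lte_fin ltr_pM2r ?invr_gt0//.
case: ifPn => // _; last by rewrite mule0.
by rewrite -!EFinB -EFinM; congr EFin; field; rewrite gt_eqF.
Qed.

Lemma ge0_integral_shift (f : R -> \bar R) (c : R) :
  measurable_fun [set: R] f -> (forall x, 0 <= f x)%E ->
  (\int[mu]_x f (x + c)%R = \int[mu]_x f x)%E.
Proof.
move=> mf f0.
have mh : measurable_fun [set: measurableTypeR R]
  (fun x => x + c : measurableTypeR R).
  exact: measurable_funD.
rewrite -[LHS](ge0_integral_pushforward mh mu measurableT mf)//.
by apply: eq_measure_integral => A mA _; exact: lebesgue_measure_shift.
Qed.

Lemma ge0_integral_dilation (f : R -> \bar R) (c : R) : 0 < c ->
  measurable_fun [set: R] f -> (forall x, 0 <= f x)%E ->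
  (\int[mu]_x f x = c%:E * \int[mu]_x f (c * x)%R)%E.
Proof.
move=> c0 mf f0.
have mh : measurable_fun [set: measurableTypeR R]
  (fun x => c * x : measurableTypeR R).
  exact: measurable_funM.
pose nu : {measure set (measurableTypeR R) -> \bar R} :=
  measure_function_pushforward__canonical__measure_function_Measure mu mh.
rewrite -[X in (_ * X)%E](ge0_integral_pushforward mh mu measurableT mf)//.
rewrite -[RHS](@ge0_integral_mscale _ _ _ nu setT measurableT
  (NngNum (ltW c0)))//.
apply: eq_measure_integral => A mA _.
exact/esym/(lebesgue_measure_dilation c0 mA).
Qed.

End one_dim.

Section powpos.
Context {R : realType}.
Local Notation mu := (@lebesgue_measure R).

(** Extending [x^(a-1)] by zero to the whole line lets all integrals range over
    the full space, the constraints being carried by the integrands.  The value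
    at [0] is that of [powR], as in the density of the Dirichlet distribution. *)
Definition powpos (a x : R) : R := (0 <= x)%R%:R * x `^ (a - 1).

Lemma powpos_ge0 a x : 0 <= powpos a x.
Proof. by rewrite /powpos mulr_ge0 ?ler0n ?powR_ge0. Qed.

Lemma lt0_powpos a x : x < 0 -> powpos a x = 0.
Proof. by move=> x0; rewrite /powpos leNgt x0 mul0r. Qed.

Lemma ge0_powpos a x : 0 <= x -> powpos a x = x `^ (a - 1).
Proof. by move=> x0; rewrite /powpos x0 mul1r. Qed.

Lemma measurable_powpos a : measurable_fun [set: R] (powpos a).
Proof.
apply: measurable_funM; last exact: measurable_powR.
rewrite (_ : (fun x : R => _) =
  \1_`[0, +oo[%classic); first exact: measurable_indic.
by apply/funext => x; rewrite indicE mem_setE in_itv/= andbT.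
Qed.

Lemma powpos_dilation a t x : 0 < t ->
  powpos a (t * x) = t `^ (a - 1) * powpos a x.
Proof.
move=> t0; have [x0|x0] := leP 0 x.
  by rewrite !ge0_powpos ?mulr_ge0 ?powRM // ltW.
by rewrite !lt0_powpos ?mulr0// pmulr_rlt0.
Qed.

(** The Beta function, with values in the extended reals. *)
Definition ebeta (a b : R) : \bar R :=
  (\int[mu]_x (powpos a x * powpos b (1 - x))%:E)%E.

(** By scaling, the convolution is homogeneous of degree [a + b - 1] in [t].
    The point [t = 0] has to be excluded: there the integrand is concentrated on
    a single point and the integral is zero, whereas [powpos (a + b) 0 = 1] if
    [a + b = 1]. *)
Lemma powpos_convolution a b t : t != 0 ->
  (\int[mu]_x (powpos a x * powpos b (t - x))%:E =
   ebeta a b * (powpos (a + b) t)%:E)%E.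
Proof.
have mab s : measurable_fun [set: R]
  (fun x => (powpos a x * powpos b (s - x))%:E).
  apply/measurable_EFinP; apply: measurable_funM;
    first exact: measurable_powpos.
  apply: (measurableT_comp (measurable_powpos b)).
  exact: measurable_funB.
move=> tn0; have [t0|t0] := ltP t 0.
  rewrite lt0_powpos// mule0 integral0_eq// => x _.
  have [x0|x0] := leP 0 x; last by rewrite lt0_powpos// mul0r.
  by rewrite (@lt0_powpos b) ?mulr0// subr_lt0 (lt_le_trans t0).
have {tn0}t0 : 0 < t by rewrite lt_def tn0.
rewrite (ge0_integral_dilation t0 (mab t)); last first.
  by move=> x; rewrite lee_fin mulr_ge0 ?powpos_ge0.
under eq_integral => x _.
  rewrite (_ : (t - t * x) = t * (1 - x)); last by rewrite mulrBr mulr1.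
  rewrite !powpos_dilation// mulrACA EFinM.
  over.
rewrite ge0_integralZl_EFin//; last 3 first.
- by move=> x _; rewrite lee_fin mulr_ge0 ?powpos_ge0.
- exact: mab.
- by rewrite mulr_ge0 ?powR_ge0.
rewrite muleA -EFinM muleC ge0_powpos ?ltW//; congr (_ * _%:E)%E.
have tn0 : t != 0 by rewrite gt_eqF.
rewrite (_ : a + b - 1 = 1 + (a - 1) + (b - 1)); last by ring.
by rewrite !powRD ?tn0 ?implybT// powRr1 ?mulrA// ltW.
Qed.

(** The Gamma integral in the extended reals, to which Tonelli's theorem applies
    before convergence is known; its finite part is [Gamma]. *)
Definition egamma (a : R) : \bar R :=
  (\int[mu]_x (powpos a x * expR (- x))%:E)%E.

Lemma measurable_powpos_expR a :
  measurable_fun [set: R] (fun x => (powpos a x * expR (- x))%:E).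
Proof.
apply/measurable_EFinP; apply: measurable_funM; first exact: measurable_powpos.
by apply: measurableT_comp => //; exact: measurableT_comp.
Qed.

Lemma GammaE a : Gamma a = fine (egamma a).
Proof.
rewrite /Gamma /egamma /Rintegral; congr fine.
have mf : measurable_fun [set: R] (fun t : R => (t `^ (a - 1) * expR (- t))%:E).
  apply/measurable_EFinP; apply: measurable_funM; first exact: measurable_powR.
  by apply: measurableT_comp => //; exact: measurableT_comp.
rewrite integral_itv_obnd_cbnd; last exact: measurable_funTS.
rewrite integral_mkcond; apply: eq_integral => x _.
rewrite patchE mem_setE in_itv/= andbT; case: ifPn => x0.
  by rewrite ge0_powpos.
by rewrite lt0_powpos ?mul0r// ltNge.
Qed.

Lemma egamma_ge0 a : (0 <= egamma a)%E.
Proof. by apply: integral_ge0 => x _;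
  rewrite lee_fin mulr_ge0 ?powpos_ge0 ?expR_ge0. Qed.

Lemma ebeta_ge0 a b : (0 <= ebeta a b)%E.
Proof. by apply: integral_ge0 => x _; rewrite lee_fin mulr_ge0 ?powpos_ge0. Qed.

(** Tonelli's theorem for [x^(a-1) y^(b-1) e^(-x-y)] after the translation
    [y := s - x]: integrating in [x] first yields the convolution.  The identity
    holds in the extended reals, before any finiteness is known. *)
Lemma egammaM a b : (egamma a * egamma b = ebeta a b * egamma (a + b))%E.
Proof.
pose f (z : measurableTypeR R * measurableTypeR R) : \bar R :=
  (powpos a z.1 * powpos b (z.2 - z.1) * expR (- z.2))%:E.
have mf : measurable_fun [set: _] f.
  apply/measurable_EFinP; apply: measurable_funM; first apply: measurable_funM.
  - exact: (measurableT_comp (measurable_powpos a)).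
  - apply: (measurableT_comp (measurable_powpos b)).
    exact: measurable_funB.
  - by apply: measurableT_comp => //; exact: measurableT_comp.
have f0 z : (0 <= f z)%E.
  by rewrite lee_fin; apply: mulr_ge0;
    [apply: mulr_ge0; exact: powpos_ge0 |exact: expR_ge0].
transitivity (\int[mu]_x \int[mu]_y f (x, y))%E.
  rewrite /egamma -ge0_integralZr//; last 3 first.
  - exact: measurable_powpos_expR.
  - by move=> x _; rewrite lee_fin mulr_ge0 ?powpos_ge0 ?expR_ge0.
  - exact: egamma_ge0.
  apply: eq_integral => x _.
  rewrite -ge0_integralZl_EFin//; last 3 first.
  - by move=> y _; rewrite lee_fin mulr_ge0 ?powpos_ge0 ?expR_ge0.
  - exact: measurable_powpos_expR.
  - by rewrite mulr_ge0 ?powpos_ge0 ?expR_ge0.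
  rewrite -[RHS](@ge0_integral_shift _ _ x)//; last first.
    exact: (measurableT_comp mf (measurable_pair1 _)).
  apply: eq_integral => y _; rewrite /f/= addrK -EFinM opprD expRD; congr EFin;
    ring.
rewrite (fubini_tonelli f mf f0).
rewrite /egamma -ge0_integralZl//; last 3 first.
- exact: measurable_powpos_expR.
- by move=> x _; rewrite lee_fin mulr_ge0 ?powpos_ge0 ?expR_ge0.
- exact: ebeta_ge0.
(* The convolution formula is available off [0], which is a null set. *)
have mD : measurable ([set: R] `\ 0) by exact: measurableD.
rewrite -(@integral_setD1 _ _ 0)//; last first.
  by apply: measurable_funTS; exact: measurable_fun_fubini_tonelli_G.
rewrite -[RHS](@integral_setD1 _ _ 0)//; last first.
  by apply: measurable_funTS; apply: emeasurable_funM => //;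
    exact: measurable_powpos_expR.
apply: eq_integral => y; rewrite inE => -[_ /eqP y0].
rewrite EFinM muleA -powpos_convolution// -ge0_integralZr//=.
- apply/measurable_EFinP; apply: measurable_funM;
    first exact: measurable_powpos.
  by apply: (measurableT_comp (measurable_powpos b)); exact: measurable_funB.
- by move=> x _; rewrite lee_fin mulr_ge0 ?powpos_ge0.
Qed.

Lemma egamma1 : egamma 1 = 1%E.
Proof.
rewrite -(@integral_exponential_pdf R 1)//; apply: eq_integral => x _.
have [x0|x0] := leP 0 x.
  rewrite /exponential_pdf patchE ifT ?mem_setE ?in_itv/= ?andbT// ge0_powpos//.
  by rewrite subrr powRr0 !mul1r mulN1r.
by rewrite lt0_powpos// lt0_exponential_pdf// mul0r.
Qed.

(** For [a < 1] the integrand is singular at [0], so the integral over [ ]0, 1] ]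
    is obtained as the monotone limit of those over [ [1/(n+1), 1] ]. *)
Lemma ebeta1 a : 0 < a -> ebeta a 1 = (a^-1)%:E.
Proof.
move=> a0; pose F n : set R := `[n.+1%:R^-1, 1]%classic.
have cF : (\bigcup_n F n) = `]0, 1]%classic.
  apply/seteqP; split => x /=.
    move=> [n _]; rewrite /F/= !in_itv/= => /andP[nx ->]; rewrite andbT.
    by rewrite (lt_le_trans _ nx)// invr_gt0.
  rewrite in_itv/= => /andP[x0 x1]; exists (Num.truncn x^-1) => //.
  rewrite /F/= in_itv/= x1 andbT invf_ple ?posrE//.
  by rewrite ltW// truncnS_gt.
have mp D : measurable_fun D (fun x : R => (x `^ (a - 1))%:E).
  by apply: measurable_funTS; apply/measurable_EFinP; exact: measurable_powR.
have -> : ebeta a 1 = (\int[mu]_(x in `]0%R, 1%R]) (x `^ (a - 1))%:E)%E.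
  rewrite integral_itv_obnd_cbnd// integral_mkcond; apply: eq_integral => x _.
  rewrite patchE mem_setE in_itv/= /powpos subrr powRr0 mulr1 subr_ge0.
  by case: (0 <= x); case: (x <= 1); rewrite ?(mul0r, mulr0, mul1r, mulr1).
rewrite -cF.
have mF n : measurable (F n) by exact: measurable_itv.
have ndF : nondecreasing_seq F.
  move=> m n mn; apply/subsetPset => x; rewrite /F/= !in_itv/= => /andP[mx ->].
  by rewrite andbT (le_trans _ mx)// lef_pV2 ?posrE// ler_nat.
have : (\int[mu]_(x in F n) (x `^ (a - 1))%:E @[n --> \oo] -->
    \int[mu]_(x in \bigcup_n F n) (x `^ (a - 1))%:E)%E.
  apply: ge0_nondecreasing_set_cvg_integral => //.
  - by move=> n; exact: mp.
  - by move=> n x _; rewrite lee_fin powR_ge0.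
move=> /(cvg_lim (@ereal_hausdorff R)) <-; apply/cvg_lim => //.
have FE n : (\int[mu]_(x in F n) (x `^ (a - 1))%:E =
    (a^-1 - n.+1%:R^-1 `^ a / a)%:E)%E.
  have [->|n0] := eqVneq n 0%N.
    rewrite /F invr1 set_itv1 integral_set1 powR1 mul1r subrr//.
  have n1 : n.+1%:R^-1 < 1 :> R by rewrite invf_lt1// ltr1n ltnS lt0n.
  have pn : 0 < n.+1%:R^-1 :> R by rewrite invr_gt0.
  have cx (c x : R) : 0 < x -> {for x, continuous (fun y => y `^ c)}.
    move=> x0; apply: differentiable_continuous; apply/derivable1_diffP.
    by apply: derivable_powR; rewrite in_itv/= andbT.
  have cF' x : 0 < x -> {for x, continuous (fun y => y `^ a / a)}.
    by move=> x0; apply: cvgMl; exact: cx.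
  rewrite /F (@continuous_FTC2 _ _ (fun y => y `^ a / a))//.
  - by rewrite powR1 mul1r.
  - apply: continuous_in_subspaceT => x; rewrite inE/= in_itv/= => /andP[nx _].
    by apply: cx; exact: lt_le_trans nx.
  - split.
    + move=> x; rewrite in_itv/= => /andP[nx _]; apply: derivableM => //.
      by apply: derivable_powR; rewrite in_itv/= andbT (lt_trans _ nx).
    + by apply: cvg_at_right_filter; exact: cF'.
    + by apply: cvg_at_left_filter; exact: cF'.
  - move=> x; rewrite in_itv/= => /andP[nx _].
    have x0 := lt_trans pn nx.
    rewrite derive1Mr; last by apply: derivable_powR; rewrite in_itv/= andbT.
    by rewrite powR_derive1 ?in_itv/= ?andbT// mulrAC divff ?gt_eqF// mul1r.
under eq_fun do rewrite FE.
apply: cvg_EFin; first by near=> n.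
rewrite -[X in _ --> X]subr0 -(mul0r a^-1).
apply: cvgB; first exact: cvg_cst.
apply: cvgMl.
have /cvg_at_rightP := powR_cvg0 a0; apply; split => [n|].
  by rewrite invr_gt0.
exact: cvg_harmonic.
Unshelve. all: by end_near. Qed.
End powpos.

Section gamma.
Context {R : realType}.
Local Notation mu := (@lebesgue_measure R).

(** This is [egammaM] for [b = 1], as [ebeta a 1 = 1 / a] and [egamma 1 = 1]. *)
Lemma egammaS (a : R) : 0 < a -> egamma (a + 1) = (a%:E * egamma a)%E.
Proof.
move=> a0; have := egammaM a 1; rewrite egamma1 mule1 (ebeta1 a0) => ->.
by rewrite muleA -EFinM divff ?mul1e// gt_eqF.
Qed.

(** The functional equation reduces finiteness at [a] to finiteness at [a + 1],
    where [x^a <= 1 + x^n] bounds the integral by values at positive integers. *)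
Lemma egamma_fin_num (a : R) : 0 < a -> egamma a \is a fin_num.
Proof.
move=> a0; suff : egamma (a + 1) \is a fin_num.
  rewrite (egammaS a0); apply: contraTT.
  rewrite !ge0_fin_numE ?mule_ge0 ?egamma_ge0 ?lee_fin ?ltW// -!leNgt
    !leye_eq => /eqP ->.
  by rewrite gt0_muley ?lte_fin.
have fn n : egamma (n%:R + 1 : R) \is a fin_num.
  elim: n => [|n IH]; first by rewrite add0r egamma1.
  by rewrite -natr1 egammaS ?fin_numM// ltr_wpDl.
set n := (Num.truncn a).+1.
have an : a <= n%:R by exact/ltW/truncnS_gt.
rewrite ge0_fin_numE ?egamma_ge0//.
apply: (@le_lt_trans _ _ (egamma (1 : R) + egamma (n%:R + 1 : R))%E);
  last first.
  by rewrite egamma1 lte_add_pinfty// ?ltry// -ge0_fin_numE ?egamma_ge0.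
rewrite -ge0_integralD//; last 4 first.
- by move=> x _; rewrite lee_fin mulr_ge0 ?powpos_ge0 ?expR_ge0.
- exact: measurable_powpos_expR.
- by move=> x _; rewrite lee_fin mulr_ge0 ?powpos_ge0 ?expR_ge0.
- exact: measurable_powpos_expR.
apply: ge0_le_integral => //.
- by move=> x _; rewrite lee_fin mulr_ge0 ?powpos_ge0 ?expR_ge0.
- exact: measurable_powpos_expR.
- by apply: emeasurable_funD; exact: measurable_powpos_expR.
move=> x _; rewrite -EFinD lee_fin -mulrDl ler_wpM2r ?expR_ge0//.
have [x0|x0] := leP 0 x; last by rewrite !lt0_powpos// addr0.
rewrite !ge0_powpos// !addrK subrr powRr0.
have [x1|/ltW x1] := leP x 1.
  rewrite ler_wpDr ?powR_ge0// [leRHS](_ : 1 = 1 `^ a); last by rewrite powR1.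
  by rewrite ge0_ler_powR ?nnegrE// ltW.
by rewrite ler_wpDl// ler_powR.
Qed.

Lemma egammaE (a : R) : 0 < a -> egamma a = (Gamma a)%:E.
Proof. by move=> a0; rewrite GammaE fineK// egamma_fin_num. Qed.

Lemma Gamma_gt0 (a : R) : 0 < a -> 0 < Gamma a.
Proof.
move=> a0; rewrite lt_def Gamma_ge0 andbT; apply/eqP => Ga0.
(* If the integral were zero, so would be the integrand almost everywhere,
   although it is positive on [ ]0, 1[ ]. *)
have I0 : (\int[mu]_x `|(powpos a x * expR (- x))%:E| = 0)%E.
  transitivity (egamma a); last by rewrite egammaE// Ga0.
  apply: eq_integral => x _.
  by rewrite gee0_abs// lee_fin mulr_ge0 ?powpos_ge0 ?expR_ge0.
have [/(_ I0)[N [mN N0 sN]] _] :=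
  ae_eq_integral_abs (mu : {measure set (measurableTypeR R) -> \bar R})
  measurableT (measurable_powpos_expR a).
have : (mu `]0%R, 1%R[ <= mu N)%E.
  apply: le_measure; rewrite ?inE// => x /=; rewrite in_itv/= => /andP[x0 x1].
  apply: sN => /= /(_ Logic.I) [] /eqP.
  by rewrite ge0_powpos ?ltW// mulf_eq0 gt_eqF ?powR_gt0//= gt_eqF// expR_gt0.
by rewrite lebesgue_measure_itv/= lte_fin ltr01 N0 sube0 lee_fin ler10.
Qed.

Lemma GammaS (a : R) : 0 < a -> Gamma (a + 1) = a * Gamma a.
Proof.
by move=> a0; apply/EFin_inj; rewrite EFinM -!egammaE ?egammaS// addr_gt0.
Qed.

Lemma ebetaE (a b : R) : 0 < a -> 0 < b ->
  ebeta a b = (Gamma a * Gamma b / Gamma (a + b))%:E.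
Proof.
move=> a0 b0; have ab0 := addr_gt0 a0 b0.
rewrite EFinM EFinM -!egammaE// egammaM -muleA [X in (_ * X)%E](_ : _ = 1%E)
  ?mule1//.
by rewrite egammaE// -EFinM divff// gt_eqF ?Gamma_gt0.
Qed.

End gamma.

(** * The Dirichlet integral *)

Section simplex_integral.
Context {R : realType}.
Local Notation mu := (@lebesgue_measure R).

Lemma ge0_integral_lebesgue_tupleS n (f : vec n.+1 R -> \bar R) :
  measurable_fun setT f -> (forall y, 0 <= f y)%E ->
  (\int[lebesgue_tuple R n.+1]_y f y =
   \int[mu]_x \int[lebesgue_tuple R n]_y f [tuple of x :: y])%E.
Proof.
move=> mf f0.
rewrite [LHS](ge0_integral_pushforward (@measurable_cons_pair R n))//.
rewrite preimage_setT.
rewrite fubini_tonelli1//;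
  first exact: measurableT_comp mf (@measurable_cons_pair R n).
by move=> z; exact: f0.
Qed.

Lemma measurable_dirichlet_kernel n (al : 'I_n -> R) be t :
  measurable_fun [set: vec n R]
  (fun y => (\prod_(i < n) powpos (al i) (tnth y i) *
     powpos be (t - \sum_(i < n) tnth y i))%:E).
Proof.
apply/measurable_EFinP; apply: measurable_funM.
  apply: (@measurable_prod _ _ _ _ _ _
    (fun i (x : vec n R) => powpos (al i) (tnth x i))) => i _.
  apply: (measurableT_comp (measurable_powpos (al i))).
  exact: measurable_tnth.
apply: (measurableT_comp (measurable_powpos be)).
apply: (measurable_funB (f := cst t)) => //.
apply: (@measurable_sum _ _ _ _ _ _ (fun j (y : vec n R) => tnth y j)).
by move=> j; exact: measurable_tnth.
Qed.

Lemma dirichlet_kernel_ge0 n (al : 'I_n -> R) be t (y : vec n R) :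
  (0 <= (\prod_(i < n) powpos (al i) (tnth y i) *
     powpos be (t - \sum_(i < n) tnth y i))%:E)%E.
Proof. by rewrite lee_fin mulr_ge0 ?powpos_ge0// prodr_ge0// => i _;
  exact: powpos_ge0. Qed.

(** Integrating out the first coordinate [x] replaces [t] by [t - x] in the
    integral over the others, so that the induction step is a convolution of
    two power functions; the induction hypothesis says nothing at [x = t], a
    null set. *)
Lemma dirichlet_integral n (al : 'I_n -> R) be t :
  (forall i, 0 < al i) -> 0 < be -> t != 0 ->
  (\int[lebesgue_tuple R n]_y (\prod_(i < n) powpos (al i) (tnth y i) *
     powpos be (t - \sum_(i < n) tnth y i))%:E =
   (\prod_(i < n) Gamma (al i) * Gamma be / Gamma (\sum_(i < n) al i + be) *
     powpos (\sum_(i < n) al i + be) t)%:E)%E.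
Proof.
elim: n al t => [|n IH] al t al0 be0 tn0.
  rewrite /= integral_dirac//; last exact: measurable_dirichlet_kernel.
  by rewrite diracT mul1e !big_ord0 subr0 add0r !mul1r divff ?mul1r// gt_eqF
    ?Gamma_gt0.
rewrite ge0_integral_lebesgue_tupleS; last 2 first.
- exact: measurable_dirichlet_kernel.
- exact: dirichlet_kernel_ge0.
pose al' i := al (lift ord0 i).
pose s := \sum_(i < n) al' i + be.
have s0 : 0 < s by rewrite ltr_wpDl// sumr_ge0// => i _; exact/ltW/al0.
pose c := \prod_(i < n) Gamma (al' i) * Gamma be / Gamma s.
have inner x : x != t -> (\int[lebesgue_tuple R n]_y
    (\prod_(i < n.+1) powpos (al i) (tnth [tuple of x :: y] i) *
     powpos be (t - \sum_(i < n.+1) tnth [tuple of x :: y] i))%:E =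
    c%:E * (powpos (al ord0) x * powpos s (t - x))%:E)%E.
  move=> xt.
  under eq_integral => y _.
    rewrite !big_ord_recl tnth0 opprD addrA -mulrA EFinM.
    under eq_bigr do rewrite tnthS.
    under [X in _ - X]eq_bigr do rewrite tnthS.
    over.
  rewrite ge0_integralZl_EFin//; last 3 first.
  - by move=> y _; exact: dirichlet_kernel_ge0.
  - exact: measurable_dirichlet_kernel.
  - exact: powpos_ge0.
  rewrite (IH al' (t - x))// ?subr_eq0 1?eq_sym//; last by move=> i; exact: al0.
  by rewrite -!EFinM mulrCA.
have mD : measurable ([set: R] `\ t) by exact: measurableD.
have mp : measurable_fun setT
  (fun x => (powpos (al ord0) x * powpos s (t - x))%:E).
  apply/measurable_EFinP; apply: measurable_funM;
    first exact: measurable_powpos.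
  by apply: (measurableT_comp (measurable_powpos s)); exact: measurable_funB.
rewrite -(@integral_setD1 _ _ t)//; last first.
  apply: measurable_funTS.
  apply: (measurable_fun_fubini_tonelli_F
    (fun z : measurableTypeR R * vec n R =>
    (\prod_(i < n.+1) powpos (al i) (tnth (cons_pair z) i) *
      powpos be (t - \sum_(i < n.+1) tnth (cons_pair z) i))%:E)).
  - exact: measurableT_comp (measurable_dirichlet_kernel _ _ _)
      (@measurable_cons_pair R n).
  - by move=> z; exact: dirichlet_kernel_ge0.
rewrite (eq_integral (fun x : measurableTypeR R => c%:E *
  (powpos (al ord0) x * powpos s (t - x))%:E)%E); last first.
  by move=> x; rewrite inE => -[_ xt]; apply: inner; exact/eqP.
rewrite integral_setD1//; last by apply: measurable_funTS;
  exact: measurable_funeM.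
rewrite ge0_integralZl_EFin//; last 2 first.
- by move=> x _; rewrite lee_fin mulr_ge0 ?powpos_ge0.
- by rewrite /c divr_ge0 ?mulr_ge0 ?Gamma_ge0// prodr_ge0// => i _;
    exact: Gamma_ge0.
rewrite powpos_convolution// ebetaE// -!EFinM !big_ord_recl -addrA -/al' -/s;
  congr EFin.
rewrite mulrA; congr (_ * _); rewrite /c.
have : Gamma s != 0 by rewrite gt_eqF// Gamma_gt0.
move: (Gamma s) (Gamma (_ + s)) (Gamma (al _)) (Gamma be) (\prod_i _) =>
  u v w z p u0.
by rewrite mulrA; congr (_ / _); field.
Qed.

End simplex_integral.

(** * Size biasing and mixed moments of the Dirichlet distribution *)

Section density_image.
Local Open Scope ereal_scope.
Context d1 d2 (X : measurableType d1) (Y : measurableType d2) (R : realType).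
Variables (m : {measure set X -> \bar R}) (nu : {measure set Y -> \bar R}).
Variables (h : X -> Y) (p : X -> R) (D : set Y).
Hypotheses (mh : measurable_fun setT h) (mp : measurable_fun setT p).
Hypotheses (p0 : forall x, (0 <= p x)%R) (mD : measurable D).
Hypothesis nuE : forall A, measurable A ->
  nu A = \int[m]_(x in h @^-1` (D `&` A)) (p x)%:E.

Import HBNNSimple.

(** Integration against the image under [h] of a measure with a density: both
    sides are continuous along increasing sequences of simple functions, and on
    indicators the claim is the hypothesis on [nu]. *)
Lemma ge0_integral_density_image (f : Y -> \bar R) :
  measurable_fun D f -> (forall y, D y -> 0 <= f y) ->
  \int[nu]_(y in D) f y = \int[m]_(x in h @^-1` D) (f (h x) * (p x)%:E).
Proof.
move=> mf f0.
have mhD A : measurable A -> measurable (h @^-1` A).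
  by move=> mA; rewrite -[X in measurable X]setTI; exact: mh.
have mpE (E : set X) : measurable_fun E (EFin \o p).
  by apply/measurable_EFinP; exact: measurable_funTS.
pose g := nnsfun_approx mD mf.
have -> : \int[nu]_(x in D) f x =
    lim (\int[nu]_(x in D) (EFin \o g n) x @[n --> \oo]).
  have fE x : D x -> f x = lim ((EFin \o g n) x @[n --> \oo]).
    by move=> Dx; apply/esym/cvg_lim => //; exact: cvg_nnsfun_approx.
  under eq_integral => x /[!inE] /fE -> //.
  apply: monotone_convergence => //.
  - move=> n; apply/measurable_EFinP.
    by apply: (measurable_funS measurableT) => //; exact/measurable_funP.
  - by move=> n x Dx //=; rewrite lee_fin.
  - by move=> x Dx a b ab; rewrite lee_fin; exact/lefP/nd_nnsfun_approx.
have mgh n : measurable_fun setT (fun x => g n (h x)).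
  by apply: measurableT_comp => //; exact: measurable_funP.
have -> : \int[m]_(x in h @^-1` D) (f (h x) * (p x)%:E) =
    lim (\int[m]_(x in h @^-1` D) ((g n (h x))%:E * (p x)%:E) @[n --> \oo]).
  have fg x : D (h x) -> f (h x) * (p x)%:E =
    lim ((g n (h x))%:E * (p x)%:E @[n --> \oo]).
    move=> Dx; apply/esym/cvg_lim => //; apply: cvgeZr => //.
    by have := @cvg_nnsfun_approx _ _ _ _ mD _ mf f0 _ Dx.
  under eq_integral => x /[!inE] /fg -> //.
  apply: monotone_convergence => [|n|n x _|x Dx a b ab].
  - exact: mhD.
  - apply: emeasurable_funM => //; apply/measurable_EFinP.
    exact: measurable_funTS.
  - by rewrite mule_ge0 ?lee_fin.
  - by rewrite lee_wpmul2r ?lee_fin//; exact/lefP/nd_nnsfun_approx.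
suff gE n : \int[nu]_(x in D) (EFin \o g n) x =
    \int[m]_(x in h @^-1` D) ((g n (h x))%:E * (p x)%:E).
  by under eq_fun do rewrite gE.
have mgi r : measurable (g n @^-1` [set r]) by exact: measurable_funPTI.
transitivity (\int[nu]_(x in D)
   (\sum_(y \in range (g n)) (y * \1_(g n @^-1` [set y]) x)%:E)).
  by apply: eq_integral => t tE; rewrite /= fimfunE -fsumEFin.
rewrite ge0_integral_fsum//; last 2 first.
- by move=> r; apply/measurable_EFinP; apply: measurable_funM => //;
    exact: measurable_funTS.
- by move=> r y Dy; exact: nnfun_muleindic_ge0.
have mgp r : measurable_fun (h @^-1` D)
  (fun x => (r * \1_(g n @^-1` [set r]) (h x))%:E).
  apply/measurable_EFinP; apply: measurable_funTS; apply: measurable_funM => //.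
  exact: (measurableT_comp (measurable_indic (mgi r)) mh).
transitivity (\int[m]_(x in h @^-1` D)
   (\sum_(y \in range (g n)) (y * \1_(g n @^-1` [set y]) (h x))%:E *
     (p x)%:E)); last first.
  apply: eq_integral => t tE; rewrite fimfunE -ge0_mule_fsuml ?fsumEFin//.
  by move=> r; exact: nnfun_muleindic_ge0.
rewrite ge0_integral_fsum//; last 3 first.
- exact: mhD.
- by move=> r; apply: emeasurable_funM.
- by move=> r x Dx; apply: mule_ge0;
    [exact: nnfun_muleindic_ge0|rewrite lee_fin].
apply: eq_fsbigr => r rg.
rewrite integralZl_indic_nnsfun// integral_indic// nuE; last exact: measurableI.
have [r0|r0] := leP 0%R r; last first.
  rewrite preimage_nnfun0// set0I setI0 preimage_set0 integral_set0 mule0.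
  by rewrite integral0_eq// => x _; rewrite indic0 mulr0 mul0e.
under [RHS]eq_integral do rewrite EFinM -muleA.
rewrite ge0_integralZl_EFin//; last 3 first.
- exact: mhD.
- by move=> x _; rewrite mule_ge0 ?lee_fin.
- apply: emeasurable_funM => //; apply/measurable_EFinP;
    apply: measurable_funTS.
  exact: (measurableT_comp (measurable_indic (mgi r)) mh).
congr (_ * _); rewrite [X in h @^-1` X](_ : _ = D `&` g n @^-1` [set r]);
  last first.
  by apply/seteqP; split => [x [? [? ?]]|x [? ?]]; split.
rewrite preimage_setI integral_mkcondr; apply: eq_integral => x _.
rewrite patchE indicE.
have [xr|xr] := pselect ((g n @^-1` [set r]) (h x)).
  by rewrite !mem_set// mul1e.
by rewrite !memNset// mul0e.
Qed.

End density_image.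

Section dirichlet.
Context {R : realType}.

Lemma rising_factorialS (s : R) m :
  rising_factorial s m.+1 = s * rising_factorial (s + 1) m.
Proof.
rewrite /rising_factorial big_ord_recl addr0; congr (_ * _).
by apply: eq_bigr => i _; rewrite -addrA -natr1 [1 + _]addrC.
Qed.

Section chart.
Variable n : nat.
Implicit Types y : vec n R.

Lemma tnth_simplex_chart_widen y (i : 'I_n) :
  tnth (@simplex_chart R n.+1 y) (widen_ord (leqnSn n) i) = tnth y i.
Proof. by rewrite tnth_mktuple /= ltnS ltn_ord (tnth_nth 0). Qed.

Lemma tnth_simplex_chart_max y :
  tnth (@simplex_chart R n.+1 y) ord_max = 1 - \sum_(i < n) tnth y i.
Proof. by rewrite tnth_mktuple /= ltnn. Qed.

Lemma simplex_ge0 (x : vec n R) i : simplex R n x -> 0 <= tnth x i.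
Proof. by move=> [/(_ i)/andP[]]. Qed.

Lemma simplex_chartP y : simplex R n.+1 (@simplex_chart R n.+1 y) <->
  (forall i, 0 <= tnth y i) /\ 0 <= 1 - \sum_(i < n) tnth y i.
Proof.
set x := @simplex_chart R n.+1 y.
have sx : \sum_i tnth x i = 1.
  rewrite big_ord_recr/= tnth_simplex_chart_max.
  under eq_bigr do rewrite tnth_simplex_chart_widen.
  by rewrite addrC subrK.
split=> [[x01 _]|[y0 t0]].
  split=> [i|]; first by rewrite -tnth_simplex_chart_widen;
    case/andP: (x01 (widen_ord (leqnSn n) i)).
  by rewrite -tnth_simplex_chart_max; case/andP: (x01 ord_max).
have x0 i : 0 <= tnth x i.
  have [im|im] := ltnP i n; last first.
    rewrite (_ : i = ord_max) ?tnth_simplex_chart_max//.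
    by apply/val_inj/eqP; rewrite eqn_leq im -ltnS ltn_ord.
  rewrite (_ : i = widen_ord (leqnSn n) (Ordinal im))
    ?tnth_simplex_chart_widen//.
  exact/val_inj.
split=> [i|]; last by rewrite /l1norm -sx; apply: eq_bigr => i _;
  rewrite ger0_norm.
by rewrite x0 -sx (bigD1 i)//= lerDl sumr_ge0.
Qed.

(** Through the chart of the simplex by its first coordinates, the density
    restricted to the simplex is the integrand of the Dirichlet integral with
    [t = 1], since some factor [powpos] vanishes as soon as one of the
    inequalities that define the simplex fails. *)
Lemma dirichlet_pdf_chart (al : 'I_n.+1 -> R) y :
  dirichlet_pdf al (@simplex_chart R n.+1 y) *
    \1_(simplex R n.+1) (@simplex_chart R n.+1 y) =
  (Gamma (\sum_i al i) / \prod_i Gamma (al i)) *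
   (\prod_(i < n) powpos (al (widen_ord (leqnSn n) i)) (tnth y i) *
     powpos (al ord_max) (1 - \sum_(i < n) tnth y i)).
Proof.
have [ys|ys] := pselect (simplex R n.+1 (@simplex_chart R n.+1 y)).
  rewrite indicE mem_set// mulr1 /dirichlet_pdf; congr (_ * _).
  have [y0 t0] := (simplex_chartP y).1 ys.
  rewrite big_ord_recr/= tnth_simplex_chart_max ge0_powpos//; congr (_ * _).
  by apply: eq_bigr => i _; rewrite tnth_simplex_chart_widen ge0_powpos.
rewrite indicE memNset// mulr0; apply/esym/eqP; rewrite mulf_eq0; apply/orP;
  right.
apply/negPn/negP; rewrite mulf_eq0 negb_or => /andP[/prodf_neq0 y0 t0];
  apply: ys.
apply/simplex_chartP; split=> [i|]; rewrite leNgt; apply/negP => h.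
  by move: (y0 i isT); rewrite lt0_powpos ?eqxx.
by move: t0; rewrite lt0_powpos ?eqxx.
Qed.

End chart.

Lemma dirichlet_simplex n (al : 'I_n.+1 -> R) : (forall i, 0 < al i) ->
  dirichlet al (simplex R n.+1) = 1%E.
Proof.
move=> al0; rewrite /dirichlet; case: eqP => [[n0]|_].
  subst n; rewrite /= diracE mem_set//; split=> [i|].
    by rewrite tnth_mktuple ler01 lexx.
  by rewrite /l1norm big_ord1 tnth_mktuple normr1.
rewrite /= /dirichlet_ac setIid integral_mkcond.
rewrite (eq_integral (fun y : vec n R =>
  ((Gamma (\sum_i al i) / \prod_i Gamma (al i))%:E *
   (\prod_(i < n) powpos (al (widen_ord (leqnSn n) i)) (tnth y i) *
     powpos (al ord_max) (1 - \sum_(i < n) tnth y i))%:E)%E)); last first.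
  move=> y _; rewrite -EFinM -dirichlet_pdf_chart patchE indicE.
  have -> : (y \in @simplex_chart R n.+1 @^-1` simplex R n.+1) =
     (@simplex_chart R n.+1 y \in simplex R n.+1) by [].
  by case: ifPn => ys; rewrite ?mulr1 ?mulr0.
have c0 : 0 <= Gamma (\sum_i al i) / \prod_i Gamma (al i).
  by rewrite divr_ge0 ?Gamma_ge0// prodr_ge0// => i _; exact: Gamma_ge0.
rewrite ge0_integralZl_EFin//; last 2 first.
- by move=> y _; exact: dirichlet_kernel_ge0.
- exact: measurable_dirichlet_kernel.
rewrite dirichlet_integral//.
rewrite ge0_powpos// powR1 mulr1 -EFinM !big_ord_recr/=; congr EFin.
have p0 (i : 'I_n.+1) : Gamma (al i) != 0 by rewrite gt_eqF// Gamma_gt0.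
rewrite mulrA divfK ?divff//; last first.
  by rewrite mulf_neq0//; apply/prodf_neq0 => i _; exact: p0.
rewrite gt_eqF// Gamma_gt0// ltr_wpDl// sumr_ge0// => i _; exact/ltW.
Qed.

Lemma measurable_dirichlet_chart n (al : 'I_n.+1 -> R) :
  measurable_fun setT (fun y => dirichlet_pdf al (@simplex_chart R n.+1 y)).
Proof.
apply: (measurableT_comp (measurable_dirichlet_pdf al)).
exact: (@measurable_simplex_chart R n.+1).
Qed.

Lemma ge0_integral_dirichlet_ac n (al : 'I_n.+1 -> R)
  (g : vec n.+1 R -> \bar R) :
  measurable_fun setT g -> (forall x, simplex R n.+1 x -> 0 <= g x)%E ->
  (\int[dirichlet_ac al]_(x in simplex R n.+1) g x =
   \int[lebesgue_tuple R n]_(y in @simplex_chart R n.+1 @^-1` simplex R n.+1)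
     (g (@simplex_chart R n.+1 y) *
       (dirichlet_pdf al (@simplex_chart R n.+1 y))%:E))%E.
Proof.
move=> mg g0.
apply: (@ge0_integral_density_image _ _ _ _ _ (lebesgue_tuple R n)
  _ (@simplex_chart R n.+1)
  (fun y => dirichlet_pdf al (@simplex_chart R n.+1 y))) => //.
- exact: (@measurable_simplex_chart R n.+1).
- exact: measurable_dirichlet_chart.
- by move=> y; exact: dirichlet_pdf_ge0.
- exact: measurable_simplex.
- exact: measurable_funTS.
Qed.

Lemma shift_at_gt0 k (al : 'I_k -> R) i : (forall j, 0 < al j) -> forall j,
  0 < shift_at al i j.
Proof. by move=> al0 j; rewrite /shift_at ltr_wpDr. Qed.

(** The factor [x_i] raises the [i]-th exponent by one, and the functional
    equation of Gamma compares the two normalizing constants.  Equality holds at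
    [x_i = 0] as well since [0 `^ (alpha i) = 0]. *)
Lemma dirichlet_pdf_shift k (al : 'I_k -> R) i (x : vec k R) :
  (forall j, 0 < al j) -> 0 <= tnth x i ->
  tnth x i * dirichlet_pdf al x =
  al i / (\sum_j al j) * dirichlet_pdf (shift_at al i) x.
Proof.
move=> al0 xi0; rewrite /dirichlet_pdf sum_shift_at.
have s0 : 0 < \sum_j al j.
  by rewrite (bigD1 i)//= ltr_pwDl// sumr_ge0// => j _; exact/ltW.
rewrite GammaS// [\prod_j Gamma (al j)](bigD1 i)//=
  [X in _ = _ * (_ / X * _)](bigD1 i)//=.
rewrite [X in _ = _ * (_ * X)](bigD1 i)//= [X in _ * (_ * X) = _](bigD1 i)//=.
have e j : j != i -> shift_at al i j = al j by rewrite /shift_at => /negPf ->;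
  rewrite addr0.
rewrite [X in _ = _ * (_ / (_ * X) * _)](eq_bigr (fun j => Gamma (al j)));
  last by move=> j /e ->.
rewrite [X in _ = _ * (_ * (_ * X))](eq_bigr
  (fun j => tnth x j `^ (al j - 1))); last by move=> j /e ->.
rewrite /shift_at eqxx GammaS// addrK -(mulr_powRB1 xi0 (al0 i)).
have : \prod_(j < k | j != i) Gamma (al j) != 0.
  by apply/prodf_neq0 => j _; rewrite gt_eqF ?Gamma_gt0.
have : Gamma (al i) != 0 by rewrite gt_eqF ?Gamma_gt0.
move: (Gamma (al i)) (\prod_(j < k | j != i) Gamma (al j)) => u v u0 v0.
move: (\prod_(j < k | j != i) _) (tnth x i `^ _) (Gamma _) => w z t.
move: (al i) (\sum_j al j) (al0 i) s0 => a s /lt0r_neq0 a0 /lt0r_neq0 s0.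
by field; rewrite a0 s0 u0 v0.
Qed.
End dirichlet.

Section moments.
Context {R : realType}.

Lemma measurable_tnth_EFin k i :
  measurable_fun setT (fun x : vec k R => (tnth x i)%:E).
Proof. by apply/measurable_EFinP; exact: measurable_tnth. Qed.

(** On a simplex of positive dimension this integrates [dirichlet_pdf_shift]; on
    the single point of the simplex for [n = 0], the factor [x_i] is [1], and
    so is [al i / |al|]. *)
Lemma ge0_integral_dirichlet_size_bias n (al : 'I_n.+1 -> R) i
  (g : vec n.+1 R -> \bar R) :
  (forall j, 0 < al j) ->
  measurable_fun setT g -> (forall x, simplex R n.+1 x -> 0 <= g x)%E ->
  (\int[dirichlet al]_(x in simplex R n.+1) ((tnth x i)%:E * g x) =
   (al i / \sum_j al j)%:E *
     \int[dirichlet (shift_at al i)]_(x in simplex R n.+1) g x)%E.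
Proof.
move=> al0 mg g0.
have mxg : measurable_fun setT (fun x : vec n.+1 R => (tnth x i)%:E * g x)%E.
  by apply: emeasurable_funM => //; exact: measurable_tnth_EFin.
have mS := @measurable_simplex R n.+1.
rewrite /dirichlet; case: eqP => [[n0]|_] /=.
  subst n; rewrite !integral_dirac//; [|exact: measurable_funTS..].
  rewrite ord1 tnth_mktuple big_ord1 divff ?mul1e ?gt_eqF//.
rewrite !ge0_integral_dirichlet_ac//; last first.
  by move=> x sx; rewrite mule_ge0 ?g0// lee_fin simplex_ge0.
rewrite -ge0_integralZl_EFin//.
- apply: eq_integral => y; rewrite inE => sy.
  rewrite muleAC -EFinM dirichlet_pdf_shift//; last exact: simplex_ge0.
  by rewrite EFinM -muleA; congr (_ * _)%E; rewrite muleC.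
- by rewrite -[X in measurable X]setTI;
    apply: (@measurable_simplex_chart R n.+1).
- by move=> y sy; rewrite mule_ge0 ?g0// lee_fin dirichlet_pdf_ge0.
- apply: measurable_funTS; apply: emeasurable_funM.
    exact: (measurableT_comp mg (@measurable_simplex_chart R n.+1)).
  by apply/measurable_EFinP; exact: measurable_dirichlet_chart.
- by rewrite divr_ge0 ?sumr_ge0// => [|j _]; exact/ltW.
Qed.

Lemma integral_dirichlet_size_bias n (al : 'I_n.+1 -> R) i
  (g : vec n.+1 R -> R) :
  (forall j, 0 < al j) -> measurable_fun setT g ->
  (dirichlet (shift_at al i)).-integrable (simplex R n.+1) (EFin \o g) ->
  (\int[dirichlet al]_(x in simplex R n.+1) (tnth x i * g x)%:E =
   (al i / \sum_j al j)%:E *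
     \int[dirichlet (shift_at al i)]_(x in simplex R n.+1) (g x)%:E)%E.
Proof.
move=> al0 mg ig.
have mEg : measurable_fun setT (EFin \o g) by exact/measurable_EFinP.
rewrite integralE [in RHS]integralE muleBr//; last first.
  by rewrite fin_num_adde_defl// fin_numN (integrable_neg_fin_num _ ig)//;
    exact: measurable_simplex.
rewrite -(ge0_integral_dirichlet_size_bias i al0 (measurable_funepos mEg))//.
rewrite -(ge0_integral_dirichlet_size_bias i al0 (measurable_funeneg mEg))//.
have S0 x : x \in simplex R n.+1 -> (0 <= (tnth x i)%:E)%E.
  by rewrite inE lee_fin; exact: simplex_ge0.
congr (_ - _)%E; apply: eq_integral => x /S0 xi0.
- by rewrite !funeposE maxe_pMr// mule0 EFinM.
- by rewrite !funenegE maxe_pMr// mule0 EFinM muleN.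
Qed.

Lemma simplex_le1 k (x : vec k R) i : simplex R k x -> tnth x i <= 1.
Proof. by move=> [/(_ i)/andP[]]. Qed.

Implicit Type k : nat.
Definition linear_form k (u : 'I_k -> R) (x : vec k R) : R :=
  \sum_(i < k) u i * tnth x i.

Lemma measurable_linear_form k (u : 'I_k -> R) :
  measurable_fun setT (linear_form u).
Proof.
apply: (@measurable_sum _ _ _ _ _ _ (fun i (y : vec k R) => u i * tnth y i)).
by move=> i; apply: measurable_funM => //; exact: measurable_tnth.
Qed.

Lemma norm_linear_form_le k (u : 'I_k -> R) x : simplex R k x ->
  `|linear_form u x| <= l1norm u.
Proof.
move=> sx; apply: le_trans (ler_norm_sum _ _ _) _; apply: ler_sum => i _.
by rewrite normrM ler_piMr// ger0_norm ?simplex_ge0 ?simplex_le1.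
Qed.

Lemma measurable_prod_linear_form k (us : seq ('I_k -> R)) :
  measurable_fun setT (fun x => \prod_(u <- us) linear_form u x).
Proof.
apply: (@measurable_prod _ _ _ _ _ _ (fun u (x : vec k R) => linear_form u x)).
by move=> u _; exact: measurable_linear_form.
Qed.

Lemma integrable_dirichlet n (al : 'I_n.+1 -> R) (g : vec n.+1 R -> R) (M : R) :
  (forall j, 0 < al j) -> measurable_fun setT g ->
  (forall x, simplex R n.+1 x -> `|g x| <= M) ->
  (dirichlet al).-integrable (simplex R n.+1) (EFin \o g).
Proof.
move=> al0 mg gM; apply: measurable_bounded_integrable.
- exact: measurable_simplex.
- by rewrite dirichlet_simplex// ltry.
- exact: measurable_funTS.
- exists M; split; first by rewrite num_real.
  by move=> M' MM' x /= sx; rewrite (le_trans (gM _ sx))// ltW.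
Qed.

Lemma norm_prod_linear_form_le k (us : seq ('I_k -> R)) x : simplex R k x ->
  `|\prod_(u <- us) linear_form u x| <= \prod_(u <- us) l1norm u.
Proof.
move=> sx; rewrite normr_prod; apply: ler_prod => u _.
by rewrite normr_ge0 norm_linear_form_le.
Qed.

(** Each linear form is expanded and its coordinates are absorbed by size
    biasing; since [|shift_at al i| = |al| + 1], the successive denominators
    [|al|], [|al| + 1] and so on multiply up to the rising factorial. *)
Lemma integral_dirichlet_prod n (us : seq ('I_n.+1 -> R)) (al : 'I_n.+1 -> R) :
  (forall j, 0 < al j) ->
  (\int[dirichlet al]_(x in simplex R n.+1)
    (\prod_(u <- us) linear_form u x)%:E =
   (polarized_rising us al / rising_factorial (\sum_j al j) (size us))%:E)%E.
Proof.
have mS := @measurable_simplex R n.+1.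
elim: us al => [|u us IH] al al0 /=.
  under eq_integral do rewrite big_nil.
  by rewrite integral_cst// mul1e dirichlet_simplex// /rising_factorial
    big_ord0 divr1.
pose g (x : vec n.+1 R) := \prod_(u <- us) linear_form u x.
have mg : measurable_fun setT g by exact: measurable_prod_linear_form.
have ig i : (dirichlet (shift_at al i)).-integrable (simplex R n.+1)
  (EFin \o g).
  apply: (integrable_dirichlet (M := \prod_(u <- us) l1norm u)) => //.
  - exact: shift_at_gt0.
  - by move=> x; exact: norm_prod_linear_form_le.
have mxg i : measurable_fun setT (fun x : vec n.+1 R => tnth x i * g x).
  by apply: measurable_funM => //; exact: measurable_tnth.
have ixg i : (dirichlet al).-integrable (simplex R n.+1)
  (fun x => (tnth x i * g x)%:E).
  apply: (integrable_dirichlet (M := \prod_(u <- us) l1norm u)) => // x sx.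
  rewrite normrM (le_trans _ (norm_prod_linear_form_le us sx))//.
  by rewrite ler_piMl// ger0_norm ?simplex_ge0 ?simplex_le1.
transitivity (\int[dirichlet al]_(x in simplex R n.+1)
    \sum_(i < n.+1) ((u i)%:E * (tnth x i * g x)%:E))%E.
  apply: eq_integral => x _; rewrite big_cons /linear_form mulr_suml -sumEFin.
  by apply: eq_bigr => i _; rewrite -mulrA EFinM.
rewrite integral_sum//; last by move=> i; exact: integrableZl.
rewrite (eq_bigr (fun i => (u i * al i * polarized_rising us (shift_at al i) *
   (rising_factorial (\sum_j al j) (size us).+1)^-1)%:E)); last first.
  move=> i _; rewrite integralZl// integral_dirichlet_size_bias//
    (IH (shift_at al i)); last exact: shift_at_gt0.
  by rewrite -!EFinM sum_shift_at rising_factorialS invfM; congr EFin; ring.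
by rewrite sumEFin mulr_suml.
Qed.

End moments.

(** * The pattern inventory *)

Section color_weight.
Variables (R : realType) (q k N : nat) (S : 'M[R]_(k, q)) (alpha : 'I_k -> R).
Variable C : 'I_N -> 'I_q.

Lemma prod_colors (V : comNzRingType) (P : pred 'I_N) (f : 'I_q -> V) :
  \prod_(l | P l) f (C l) = \prod_j f j ^+ #|[set l | P l && (C l == j)]%SET|.
Proof.
rewrite (partition_big C predT)//=; apply: eq_bigr => j _.
rewrite (eq_bigr (fun=> f j)) => [|l /andP[_ /eqP ->]//].
by rewrite prodr_const; congr (_ ^+ _); apply: eq_card => l; rewrite !inE.
Qed.

Lemma cycle_colors_neq0 (p : 'S_N) c : c \in porbits p ->
  cycle_colors C c != [ffun=> 0%N].
Proof.
move=> /imsetP[z _ ->]; apply/eqP => /ffunP/(_ (C z)).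
rewrite !ffunE => /eqP; rewrite cards_eq0 => /eqP/setP/(_ z).
by rewrite !inE porbit_id eqxx.
Qed.

Lemma omega_cycle_colors (a : pos_multiindex q) (c : {set 'I_N}) :
  cycle_colors C c = val a -> omega S alpha a =
    cycle_weight alpha (fun l i => S i (C l)) c.
Proof.
move=> ca; apply: eq_bigr => i _; congr (_ * _).
rewrite (prod_colors (mem c) (fun j => S i j)); apply: eq_bigr => j _.
by rewrite -ca ffunE.
Qed.

(** Grouping the cycles of [p] by their color counts turns the product over
    cycles into the product over multi-indices with multiplicities. *)
Lemma weight_color (p : 'S_N) :
  weight S alpha (color C p) =
  \prod_(c in porbits p) cycle_weight alpha (fun l i => S i (C l)) c.
Proof.
set W := cycle_weight _ _.
transitivity (\prod_(a <- finsupp (color C p))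
    \prod_(c in porbits p | cycle_colors C c == val a) W c).
  apply: eq_bigr => a _; rewrite colorE /cycle_count.
  rewrite (eq_bigr (fun=> omega S alpha a)) => [|c /andP[_ /eqP ca]];
    last first.
    by rewrite (omega_cycle_colors ca).
  by rewrite prodr_const; congr (_ ^+ _); apply: eq_card => c; rewrite !inE.
rewrite (exchange_big_dep (mem (porbits p)))/=; last by move=> a c _ /andP[].
apply: eq_bigr => c cp.
pose a : pos_multiindex q := Sub (cycle_colors C c) (cycle_colors_neq0 cp).
rewrite (eq_bigl (pred1 a)) => [|b]; last first.
  by rewrite cp /= eq_sym -val_eqE.
rewrite big_mkcond (bigD1_seq a)/=; last exact: fset_uniq.
  by rewrite eqxx big1 ?mulr1// => b /negPf ->.
rewrite mem_finsupp colorE /cycle_count cards_eq0; apply/set0Pn; exists c.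
by rewrite inE cp /= eqxx.
Qed.

Lemma pattern_inventoryE :
  pattern_inventory S alpha C =
  N`!%:R^-1 * polarized_rising [seq (fun i => S i (C l)) | l <- enum 'I_N]
    alpha.
Proof.
rewrite -(cycle_sumE alpha (fun l i => S i (C l))) ?enum_uniq//.
rewrite /pattern_inventory; congr (_ * _); rewrite /cycle_sum;
  apply: eq_big => p.
  suff -> : perm_on [set l in enum 'I_N]%SET p by [].
  by apply/fintype.subsetP => l _; rewrite inE mem_enum.
move=> _; rewrite weight_color; apply: eq_bigl => c.
rewrite andbC (_ : c \subset _)//.
by apply/fintype.subsetP => l _; rewrite inE mem_enum.
Qed.

End color_weight.

Theorem theorem6p1 (R : realType) (q k : nat) (hq : (0 < q)%N) (hk : (0 < k)%N)
    (n : 'I_q -> nat)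
    (C : 'I_(\sum_(j < q) n j) -> 'I_q) (hC : is_coloring n C)
    (S : 'M[R]_(k, q)) (alpha : 'I_k -> R) (halpha : forall i, 0 < alpha i) :
  (\int[dirichlet alpha]_(x in simplex R k)
     (\prod_(j < q) (\sum_(i < k) S i j * tnth x i) ^+ n j)%R%:E =
   ((\sum_(j < q) n j)%N`!%:R
      / rising_factorial (l1norm alpha) (\sum_(j < q) n j)%N
      * pattern_inventory S alpha C)%:E)%E.
Proof.
case: k hk S alpha halpha => // k _ S alpha halpha.
(* Color [j] is used [n j] times, so the integrand is a product of linear forms
   indexed by the elements to be permuted. *)
pose us := [seq (fun i => S i (C l)) | l <- enum 'I_(\sum_(j < q) n j)].
transitivity (\int[dirichlet alpha]_(x in simplex R k.+1)
    (\prod_(u <- us) linear_form u x)%:E)%E.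
  apply: eq_integral => x _; congr EFin.
  rewrite /us big_map big_enum/=
    (prod_colors C predT (fun j => \sum_i S i j * tnth x i)).
  by apply: eq_bigr => j _; congr (_ ^+ _); rewrite -(hC j).
rewrite integral_dirichlet_prod// size_map size_enum_ord; congr EFin.
rewrite pattern_inventoryE -/us /l1norm.
rewrite (eq_bigr (fun j => `|alpha j|)) => [|j _];
  last by rewrite ger0_norm// ltW.
have f0 : (\sum_(j < q) n j)`!%:R != 0 :> R by rewrite pnatr_eq0 -lt0n fact_gt0.
by rewrite mulrA [_ / _ / _]mulrAC divff// mul1r mulrC.
Qed.
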